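(* Let $(T,X,\pi)$ be a topological semiflow on a uniform topological space $(X,\mathscr{U}_X)$, where $T$ is a topological semigroup. If $(T,X,\pi)$ is Devaney chaotic, then it is sensitive to initial conditions, and thus $X$ has no isolated points.
   Context: A topological semiflow $(T,X,\pi)$ consists of a topological semigroup $T$ (not necessarily discrete), a topological space $X$ and a jointly continuous map $\pi\colon T\times X\to X$, $(t,x)\mapsto tx$, with $s(tx)=(st)x$ for all $s,t\in T$, $x\in X$, and $ex=x$ for all $x$ if $T$ has a neutral element $e$. Write $Tx=\{tx : t\in T\}$ and $t^{-1}V=\{x\in X : tx\in V\}$. Here $\mathscr{U}_X$ is a symmetric uniform structure compatible with the topology of $X$, and $\varepsilon[x]=\{y : (x,y)\in\varepsilon\}$ for $\varepsilon\in\mathscr{U}_X$. A subset $B\subseteq T$ is syndetic if there is a compact $K\subseteq T$ with $Kt\cap B\neq\emptyset$ for all $t\in T$. A point $x\in X$ is periodic if $\{t\in T : tx=x\}$ is syndetic in $T$. $(T,X,\pi)$ is topologically transitive if for all nonempty open $U,V\subseteq X$ there is $t\in T$ with $U\cap t^{-1}V\neq\emptyset$. It is minimal if $\overline{Tx}=X$ for every $x\in X$. It is Devaney chaotic if (1) it is topologically transitive, (2) its periodic points are dense in $X$, and (3) it is not minimal. It is sensitive to initial conditions if there is $\varepsilon\in\mathscr{U}_X$ such that for every $x\in X$ and every $\delta\in\mathscr{U}_X$ there are $y\in\delta[x]$ and $t\in T$ with $(tx,ty)\notin\varepsilon$. *)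

(* Defs.v *)
From HB Require Import structures.
From mathcomp Require Import all_boot.
From mathcomp Require Import boolp classical_sets topology.

Set Implicit Arguments.
Unset Strict Implicit.
Unset Printing Implicit Defensive.

Local Open Scope classical_set_scope.
Local Open Scope group_scope.

HB.mixin Record isTopologicalSemigroup T of Topological T & Semigroup T := {
  mul_continuous : continuous (fun p : T * T => p.1 * p.2)
}.

(* No separation axiom is imposed. *)
#[short(type="topologicalSemigroupType")]
HB.structure Definition TopologicalSemigroup :=
  {T of Topological T & Semigroup T & isTopologicalSemigroup T}.

Record semiflow (T : topologicalSemigroupType) (X : topologicalType) := Semiflow {
  act :> T -> X -> X;
  act_continuous : continuous (fun p : T * X => act p.1 p.2);
  actM : forall (s t : T) (x : X), act s (act t x) = act (s * t) x;
  act1 : forall e : T, left_id e (@mul T) -> right_id e (@mul T) ->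
    forall x : X, act e x = x
}.

Definition syndetic (T : topologicalSemigroupType) (B : set T) : Prop :=
  exists2 K : set T, compact K &
    forall t : T, [set k * t | k in K] `&` B !=set0.

Section TopologicalDynamics.
Variables (T : topologicalSemigroupType) (X : topologicalType).
Variable pi : semiflow T X.

Definition orbit (x : X) : set X := [set pi t x | t in [set: T]].

Definition periodic (x : X) : Prop := syndetic [set t : T | pi t x = x].

Definition topologically_transitive : Prop :=
  forall U V : set X, open U -> open V -> U !=set0 -> V !=set0 ->
    exists t : T, U `&` (pi t @^-1` V) !=set0.

Definition minimal : Prop := forall x : X, closure (orbit x) = [set: X].

Definition devaney_chaotic : Prop :=
  [/\ topologically_transitive,
      dense [set x : X | periodic x] &
      ~ minimal].

End TopologicalDynamics.

Definition sensitive (T : topologicalSemigroupType) (X : uniformType)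
    (pi : semiflow T X) : Prop :=
  exists2 e : set (X * X), entourage e &
    forall (x : X) (d : set (X * X)), entourage d ->
      exists2 y : X, y \in xsection d x &
        exists t : T, ~ e (pi t x, pi t y).

(* Main.v *)
Require Import Defs.
From HB Require Import structures.
From mathcomp Require Import all_boot.
From mathcomp Require Import boolp classical_sets topology.

(** Devaney chaos forces sensitivity because a region without sensitivity
    would drag every point of the space into the closure of every orbit.

    Suppose that the semiflow is not sensitive.  Then for each entourage [e]
    there is a nonempty open set [O] all of whose points have forever [e]-close
    trajectories ([not_sensitive_stable_open]).  By non-minimality, fix [x0] and
    a point [y0] off the closure of the orbit of [x0].  Transitivity and density
    of the periodic points give a periodic [p] in [O] and a time [t0] for which
    [t0 p] is close to [y0].  Let [K] be a compact set of return times of [p]: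
    whatever [s] is, [k s p = p] for some [k] in [K].

    The maps [t0 k], for [k] in [K], are equicontinuous at [x0]
    ([compact_equicontinuous]), so every point near enough to [x0] is sent by
    all of them close to the orbit of [x0].  By transitivity some [z] in [O]
    reaches such a point at some time [s]; choose [k] with [k s p = p].  Then
    [t0 k s z] is close to [t0 k x0], a point of the orbit of [x0], and also, as
    [z] and [p] are both in [O], close to [t0 k s p = t0 p], hence to [y0].
    This puts [y0] next to the orbit of [x0], a contradiction.

    Finally, an isolated point has a neighbourhood in which there is no second
    trajectory to diverge from its own ([sensitive_not_isolated]). *)

Set Implicit Arguments.
Unset Strict Implicit.
Unset Printing Implicit Defensive.

Local Open Scope classical_set_scope.

(** The tube lemma in uniform form: each [k] in [K] has a neighbourhood that
    works together with some neighbourhood of [x], and finitely many of these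
    cover [K]. *)
Lemma compact_equicontinuous (S X : topologicalType) (Y : uniformType)
    (f : S * X -> Y) (K : set S) (x : X) (e : set (Y * Y)) :
  continuous f -> compact K -> entourage e ->
  \forall w \near x, forall k, K k -> e (f (k, w), f (k, x)).
Proof.
move=> cf /compact_near_coveringP cK ent_e.
apply: (cK X (nbhs x) (fun w k => e (f (k, w), f (k, x)))) => k _.
(* Both [f (k', w)] and [f (k', x)] are compared with [f (k, x)]. *)
have close e' : entourage e' -> \forall q \near (k, x), e' (f (k, x), f q).
  move=> /(nbhs_entourage (f (k, x)))/(cf (k, x)).
  by apply: (@filterS _ (nbhs (k, x))) => q /xsectionP.
have ent_h := entourage_split_ent ent_e.
have [[A B] /= [nA nB] ABc] := close _ ent_h.
have [[A' B'] /= [nA' nB'] ABc'] := close _ (entourage_inv ent_h).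
exists (A `&` A', B') => /=; first by split => //; exact: filterI.
move=> [k' w] /= [[Ak' A'k'] B'w].
apply: (entourage_split (f (k, x))) => //.
  exact: (ABc' (k', w)).
by apply: (ABc (k', x)); split => //=; exact: nbhs_singleton nB.
Qed.

Section TopologicalDynamics.
Variables (T : topologicalSemigroupType) (X : uniformType) (pi : semiflow T X).

Lemma act_time_continuous (t : T) : continuous (pi t).
Proof.
move=> x; apply: (@continuous_comp _ _ _ (fun y => (t, y))
  (fun p : T * X => pi p.1 p.2)); last exact: act_continuous.
by apply: cvg_pair; [exact: cvg_cst | exact: cvg_id].
Qed.

(** Failure of sensitivity only compares trajectories with that of one centre
    [x]; halving the entourage compares them with each other. *)
Lemma not_sensitive_stable_open (e : set (X * X)) :
  ~ sensitive pi -> entourage e ->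
  exists O : set X, [/\ open O, O !=set0 &
    forall y z, O y -> O z -> forall t, e (pi t y, pi t z)].
Proof.
move=> nsens ent_e.
pose e' := split_ent e `&` (split_ent e)^-1%relation.
have ent_e' : entourage e'.
  by apply: filterI; [|apply: entourage_inv]; exact: entourage_split_ent.
have [x [d [ent_d dx]]] : exists x d, entourage d /\
    forall y, d (x, y) -> forall t, e' (pi t x, pi t y).
  apply: contrapT => H; apply: nsens; exists e' => // x d ent_d.
  apply: contrapT => H'; apply: H; exists x, d; split => // y dxy t.
  apply: contrapT => net; apply: H'; exists y; first exact/mem_set/xsectionP.
  by exists t.
exists (interior (xsection d x)); split; first exact: open_interior.
  by exists x; exact: nbhs_entourage.
move=> y z /interior_subset/xsectionP dy /interior_subset/xsectionP dz t.
have [_ ?] := dx _ dy t; have [? _] := dx _ dz t.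
exact: (entourage_split (pi t x)).
Qed.

Lemma transitive_dense_periodic_moving (O V : set X) :
  topologically_transitive pi -> dense [set x | periodic pi x] ->
  open O -> open V -> O !=set0 -> V !=set0 ->
  exists p t, [/\ O p, periodic pi p & V (pi t p)].
Proof.
move=> trans dper oO oV O0 V0.
have [t OV0] := trans _ _ oO oV O0 V0.
have oOV : open (O `&` pi t @^-1` V).
  apply: openI => //; apply: open_comp => // x _.
  exact: act_time_continuous.
by have [p [[Op Vp] perp]] := dper _ OV0 oOV; exists p, t.
Qed.

Lemma devaney_chaotic_sensitive : devaney_chaotic pi -> sensitive pi.
Proof.
move=> [trans dper nmin]; apply: contrapT => nsens.
have [x0 [y0 ny0]] : exists x0 y0, ~ closure (Defs.orbit pi x0) y0.
  apply: contrapT => H; apply: nmin => x; apply/seteqP; split=> // y _.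
  by apply: contrapT => H'; apply: H; exists x, y.
have [E ent_E Ey0] : exists2 E : set (X * X), entourage E &
    forall t, ~ E (y0, pi t x0).
  apply: contrapT => H; apply: ny0 => B; rewrite -nbhs_entourageE /=.
  move=> [E ent_E EB]; apply: contrapT => H'; apply: H; exists E => // t Et.
  by apply: H'; exists (pi t x0); split; [exists t | apply/EB/xsectionP].
pose E1 := split_ent E; pose E2 := split_ent E1.
have ent_E1 : entourage E1 by exact: entourage_split_ent.
have ent_E2 : entourage E2 by exact: entourage_split_ent.
have [O [oO O0 stO]] := not_sensitive_stable_open nsens ent_E2.
have [p [t0 [Op [K cK retK] /interior_subset/xsectionP y0p]]] :
    exists p t, [/\ O p, periodic pi p & interior (xsection E1 y0) (pi t p)].
  apply: transitive_dense_periodic_moving => //; first exact: open_interior.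
  by exists y0; exact: nbhs_entourage.
have /(compact_equicontinuous x0)/(_ cK ent_E2) nearW :
    continuous (fun q : T * X => pi t0 (pi q.1 q.2)).
  move=> q; apply: (@continuous_comp _ _ _ (fun q : T * X => pi q.1 q.2)).
    exact: act_continuous.
  exact: act_time_continuous.
have [s [z [Oz /interior_subset Wz]]] :=
  trans _ _ oO (open_interior _) O0 (ex_intro _ x0 nearW).
have [_ [[k Kk <-] /= ksp]] := retK s.
(* The chain is [y0], [t0 p = t0 k s p], [t0 k s z], [t0 k x0]. *)
apply: (Ey0 (mul t0 k)); rewrite -actM.
apply: (entourage_split (pi t0 p)) => //.
apply: (entourage_split (pi t0 (pi k (pi s z)))) => //; last exact: Wz.
by rewrite -[X in pi t0 X]ksp -actM !(actM pi t0) !(actM pi _ s); exact: stO.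
Qed.

Lemma sensitive_not_isolated (x : X) :
  sensitive pi -> ~ isolated [set: X] x.
Proof.
move=> [e ent_e sens] [_ [V nV Vx]].
move: nV; rewrite -nbhs_entourageE /= => -[d ent_d dV].
have [y /set_mem dy [t]] := sens x d ent_d; apply.
have -> : y = x by have : (V `&` setT) y; [split => //; exact: dV | rewrite Vx].
exact: entourage_refl.
Qed.

End TopologicalDynamics.

Theorem proposition2p10 (T : topologicalSemigroupType) (X : uniformType)
    (pi : semiflow T X) (hpi : devaney_chaotic pi) :
  sensitive pi /\ (forall x : X, ~ isolated [set: X]%classic x).
Proof.
have sens := devaney_chaotic_sensitive hpi.
by split=> // x; exact: (sensitive_not_isolated sens).
Qed.
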